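(* Let $A = (a_{ij})_{i,j=1}^n$ be a real strictly row diagonally dominant matrix with $a_{ii} < 0$, $i = 1, \ldots, n$. Denote $s_i := \frac{\sum_{j \neq i}|a_{ij}|}{|a_{ii}|}$. Then $A$ is relatively $D$-stable for any value of $\theta$ satisfying $$\frac{\pi}{2} > \theta > \arcsin \max_i s_i.$$
   Context: An $n \times n$ matrix $A$ is strictly row diagonally dominant if $|a_{ii}| > \sum_{j\neq i}|a_{ij}|$ for all $i = 1,\ldots,n$. A positive diagonal matrix is a diagonal matrix with all diagonal entries $>0$. For $0 < \theta < \frac{\pi}{2}$ let $\mathbb{C}^0_{\theta} = \{z = x+iy \in \mathbb{C} : x < 0,\ x\tan\theta < y < -x\tan\theta\}$. For a given $\theta$, a real $n\times n$ matrix $M$ is called relatively $D$-stable if all eigenvalues of $DM$ lie in $\mathbb{C}^0_\theta$ for every positive diagonal matrix $D$. *)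

(* Defs.v *)
From HB Require Import structures.
From mathcomp Require Import all_boot all_order all_algebra.
From mathcomp Require Import complex.
From mathcomp Require Import reals trigo.

Set Implicit Arguments.
Unset Strict Implicit.
Unset Printing Implicit Defensive.

Import Order.TTheory GRing.Theory Num.Theory.

Local Open Scope ring_scope.

Definition strictly_row_diag_dominant (R : realType) (n : nat) (A : 'M[R]_n) :=
  forall i : 'I_n, \sum_(j < n | j != i) `|A i j| < `|A i i|.

Definition positive_diagonal (R : realType) (n : nat) (D : 'M[R]_n) :=
  is_diag_mx D /\ forall i : 'I_n, 0 < D i i.

(* Open sector around the negative real half-axis with half-angle theta,
   meant for 0 < theta < pi / 2. *)
Definition left_sector (R : realType) (theta : R) (z : R[i]) :=
  let x := complex.Re z in
  let y := complex.Im z in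
  x < 0 /\ x * tan theta < y < - x * tan theta.

(* The real matrix D *m M is viewed over R[i], so that all of its complex
   eigenvalues are constrained. *)
Definition relatively_D_stable (R : realType) (theta : R) (n : nat)
    (M : 'M[R]_n) :=
  forall D : 'M[R]_n, positive_diagonal D ->
  forall lambda : R[i],
    eigenvalue (map_mx (real_complex R) (D *m M)) lambda ->
    left_sector theta lambda.

Definition dominance_ratio (R : realType) (n : nat) (A : 'M[R]_n) (i : 'I_n) : R :=
  (\sum_(j < n | j != i) `|A i j|) / `|A i i|.

(* The ratios are nonnegative, so the default value 0 of the iterated maximum
   does not affect it when 0 < n. *)
Definition max_dominance_ratio (R : realType) (n : nat) (A : 'M[R]_n) : R :=
  \big[Num.max/0]_(i < n) dominance_ratio A i.

(* Main.v *)
Require Import Defs.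
From HB Require Import structures.
From mathcomp Require Import all_boot all_order all_algebra.
From mathcomp Require Import complex.
From mathcomp Require Import reals trigo.
From mathcomp Require Import ring lra.
Import Order.TTheory GRing.Theory Num.Theory.
Local Open Scope ring_scope.

(** By Gershgorin's theorem every eigenvalue of [D *m A] lies in a disc centred
at [- c], with [c = d_i * `|a_ii| > 0], of radius [s_i * c], where [s_i < 1]:
the radius scales with the centre, so that the disc is contained in the cone
with half-angle [arcsin s_i], whatever [D] is. *)

Lemma eigenvalue_trmx (F : fieldType) (n : nat) (B : 'M[F]_n) (a : F) :
  eigenvalue B^T a = eigenvalue B a.
Proof.
rewrite !eigenvalue_root_char /root /char_poly -[in RHS]det_tr.
congr (_.[a] == 0); congr (\det _).
by apply/matrixP => i j; rewrite !mxE eq_sym.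
Qed.

(** At an index [i] where an eigenvector has an entry of largest modulus, the [i]-th eigenvector
    equation bounds [a - B i i] after division by that entry. *)
Lemma Gershgorin (F : numFieldType) (n : nat) (B : 'M[F]_n) (a : F) :
  eigenvalue B a ->
  exists i : 'I_n, `|a - B i i| <= \sum_(j < n | j != i) `|B i j|.
Proof.
(* MathComp eigenvectors are row vectors, whereas row sums call for columns. *)
rewrite -eigenvalue_trmx => /eigenvalueP[v vB v_neq0].
have [i0 vi0] : exists i0, v 0 i0 != 0.
  apply/existsP; apply: contraNT v_neq0; rewrite negb_exists => /forallP v0.
  by apply/eqP/rowP => j; rewrite mxE; apply/eqP; rewrite -[_ == _]negbK.
(* The order of [F] is only partial, but norms are real and hence comparable. *)
have [i _ vmax] := @real_arg_maxP _ _ i0 xpredT (fun i => `|v 0 i|) isT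
  (fun i _ => normr_real (v 0 i)).
have vi_gt0 : 0 < `|v 0 i| by apply: lt_le_trans (vmax i0 isT); rewrite normr_gt0.
exists i; rewrite -(ler_pM2r vi_gt0) -normrM mulr_suml.
have -> : (a - B i i) * v 0 i = \sum_(j < n | j != i) B i j * v 0 j.
  have /rowP/(_ i) := vB; rewrite !mxE (bigD1 i) //= mxE => vBi.
  rewrite mulrBl -vBi mulrC addrAC subrr add0r.
  by apply: eq_bigr => j _; rewrite mxE mulrC.
apply: le_trans (ler_norm_sum _ _ _) _; apply: ler_sum => j _.
by rewrite normrM ler_wpM2l //; exact: vmax.
Qed.

(** The angle enters only through its sine and cosine, which turns containment in the sector into
    polynomial inequalities. *)
Lemma disc_left_sector (R : realType) (theta s c : R) (z : R[i]) :
  0 < c -> 0 <= s < 1 -> 0 < cos theta -> s < sin theta ->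
  `|z + c%:C%C| <= (s * c)%:C%C -> left_sector theta z.
Proof.
move=> c_gt0 /andP[s_ge0 s_lt1] cos_gt0 s_lt_sin.
case: z => x y hz; rewrite /left_sector /=.
have sc_ge0 : 0 <= s * c by rewrite mulr_ge0 // ltW.
have {hz} disc : (x + c) ^+ 2 + y ^+ 2 <= (s * c) ^+ 2.
  have : `|(x +i* y)%C + c%:C%C| ^+ 2 <= (s * c)%:C%C ^+ 2.
    by rewrite ler_sqr ?nnegrE // lecR.
  by rewrite -add_Re2_Im2 /= addr0 -rmorphXn /= lecR.
have sc2_lt : (s * c) ^+ 2 < c ^+ 2.
  by rewrite ltr_sqr ?nnegrE // ?(ltW c_gt0) // gtr_pMl.
(* A point with [x >= 0] lies at distance at least [c] from the centre, beyond the radius. *)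
have x_lt0 : x < 0.
  rewrite ltNge; apply/negP => x_ge0.
  have := mulr_ge0 x_ge0 (ltW c_gt0); have := sqr_ge0 x; have := sqr_ge0 y.
  by lra.
have x2_gt0 : 0 < x ^+ 2 by rewrite exprn_even_gt0 //= lt_eqF.
(* The square below is tangency of the disc to the cone: it vanishes exactly at
   the abscissa of the two contact points. *)
have cone_s : y ^+ 2 * (1 - s ^+ 2) <= x ^+ 2 * s ^+ 2.
  have : 0 <= (x + c * (1 - s ^+ 2)) ^+ 2 by exact: sqr_ge0.
  by nra.
have sin_gt0 : 0 < sin theta by exact: le_lt_trans s_lt_sin.
have sin2_gt : s ^+ 2 < sin theta ^+ 2.
  by rewrite ltr_sqr ?nnegrE // ltW.
(* Passing from [s] to [sin theta] can only lower the left side of [cone_s] and strictly raises the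
   right one, as [x] is nonzero. *)
have cone : y ^+ 2 * cos theta ^+ 2 < x ^+ 2 * sin theta ^+ 2.
  have := cos2Dsin2 theta; have := sqr_ge0 y => *.
  by nra.
have : `|y * cos theta| < `|x * sin theta|.
  by rewrite -ltr_sqr ?nnegrE // !real_normK ?num_real // !exprMn.
rewrite (ltr0_norm (x := x * _)) ?nmulr_rlt0 // ltr_norml opprK => ycos.
split=> //; rewrite /tan mulNr mulrA -mulNr.
by rewrite ltr_pdivrMr // ltr_pdivlMr // mulNr.
Qed.

Theorem theorem12 (R : realType) (n : nat) (A : 'M[R]_n)
    (hdom : strictly_row_diag_dominant A)
    (hneg : forall i : 'I_n, A i i < 0)
    (theta : R)
    (htheta_lt : theta < pi / 2)
    (htheta_gt : asin (max_dominance_ratio A) < theta) :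
  relatively_D_stable theta A.
Proof.
have norm_gt0 i : 0 < `|A i i| by rewrite normr_gt0 lt_eqF.
have ratio_lt1 i : dominance_ratio A i < 1.
  by rewrite /dominance_ratio ltr_pdivrMr // mul1r hdom.
set m := max_dominance_ratio A in htheta_gt.
have m_ge0 : 0 <= m by exact: bigmax_ge_id.
(* The default value 0 of the maximum is also below 1, which covers [n = 0]. *)
have m_lt1 : m < 1 by apply: bigmax_lt.
have m_itv : -1 <= m <= 1 by apply/andP; split; lra.
have asin_ge : - (pi / 2) <= asin m by exact: asin_geNpi2.
have asin_le : asin m <= pi / 2 by exact: asin_lepi2.
have cos_gt0 : 0 < cos theta.
  by apply: cos_gt0_pihalf; rewrite htheta_lt (le_lt_trans asin_ge).
(* Sine is increasing on [-pi/2, pi/2], which contains both [asin m] and [theta]. *)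
have m_lt_sin : m < sin theta.
  rewrite -(@asinK _ m) ?in_itv // ltr_sin // in_itv /=.
    by rewrite asin_ge.
  by rewrite (ltW htheta_lt) (ltW (le_lt_trans asin_ge _)).
move=> D [/is_diag_mxP D_diag D_gt0] z z_eigen.
case: (Gershgorin _ _ _ _ z_eigen) => i.
have DA j k : (D *m A) j k = D j j * A j k.
  rewrite mxE (bigD1 j) //= big1 ?addr0 // => l l_neq_j.
  by rewrite D_diag ?mul0r // eq_sym.
rewrite mxE DA => hz.
apply: (@disc_left_sector _ theta (dominance_ratio A i) (D i i * `|A i i|)).
- by rewrite mulr_gt0.
- by rewrite ratio_lt1 divr_ge0 ?sumr_ge0.
- by [].
- by apply: le_lt_trans m_lt_sin; exact: le_bigmax.
rewrite (ltr0_norm (hneg i)) mulrN rmorphN.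
apply: (le_trans hz); rewrite le_eqVlt; apply/orP; left; apply/eqP.
(* The two radii agree: [D i i] scales the whole row, and [|A i i|] cancels against the denominator
   of the ratio. *)
rewrite -mulrN -(ltr0_norm (hneg i)) mulrCA /dominance_ratio divfK ?gt_eqF //.
rewrite mulr_sumr rmorph_sum /=; apply: eq_bigr => j _.
by rewrite mxE DA normc_def /= expr0n addr0 sqrtr_sqr normrM gtr0_norm.
Qed.
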